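(* Let $\tau$ be a set of positions that is DN for a logic program $P$. Then the filter $\Delta[\tau]$ associated to $\tau$ is DN for $P$.
   Context: Fix a first-order language $\mathcal L$ with infinitely many constant symbols; $\Pi$ is its set of relation symbols, each $p$ with unique arity $arity(p)$; $TU_{\mathcal L}$ is the set of all terms; $[1,n]=\{1,\dots,n\}$. A query is a finite sequence of atoms; a logic program is a finite set of definite clauses. SLD-derivation step: given a query $\mathbf A,B,\mathbf C$ and a clause $c$, take a variant $H\leftarrow\mathbf B$ of $c$ variable disjoint from the query with $B,H$ unifiable and mgu $\theta$; then $\mathbf A,B,\mathbf C\Rightarrow_c^\theta(\mathbf A,\mathbf B,\mathbf C)\theta$ (selected atom $B$). A term-condition is a map $TU_{\mathcal L}\to\{\mathtt{true},\mathtt{false}\}$. A filter $\Delta$ assigns to each $p\in\Pi$ a partial function $\Delta(p)$ from $[1,arity(p)]$ to term-conditions. For a substitution $\eta$, an atom $A=p(s_1,\dots,s_n)$ is $\Delta$-more general than $B$ for $\eta$ if $B=p(t_1,\dots,t_n)$, $t_i=s_i\eta$ for $i\notin Dom(\Delta(p))$, and $\Delta(p)(i)(s_i)=\mathtt{true}$ for $i\in Dom(\Delta(p))$; a query $A_1,\dots,A_n$ is $\Delta$-more general than $B_1,\dots,B_m$ for $\eta$ if $n=m$ and componentwise for the same $\eta$; ''$\Delta$-more general'' means for some $\eta$. For one-step sequences $Q\Rightarrow_cQ_1$ and $Q'\Rightarrow_cQ'_1$, the latter is a $\Delta$-lift of the former if $Q'$ is $\Delta$-more general than $Q$, $Q'_1$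 is $\Delta$-more general than $Q_1$, and atoms in the same positions are selected in $Q$ and $Q'$. $\Delta$ is DN for a clause $c$ if for every step $Q\Rightarrow_cQ_1$ and every query $Q'$ $\Delta$-more general than $Q$ there is $Q'_1$ with $Q'\Rightarrow_cQ'_1$ a $\Delta$-lift of $Q\Rightarrow_cQ_1$; DN for $P$ if DN for each clause of $P$. A set of positions $\tau$ maps each $p\in\Pi$ to a subset $\tau(p)\subseteq[1,arity(p)]$. Its associated filter $\Delta[\tau]$ maps each $p$ to the function with domain $\tau(p)$ sending every $i\in\tau(p)$ to the constant term-condition $f_{\mathit{true}}$ ($t\mapsto\mathtt{true}$ for all $t$). $\tau$ is DN for a clause $p(s_1,\dots,s_n)\leftarrow\mathbf B$ if for every $i\in\tau(p)$: $s_i$ is a variable, $s_i$ occurs only once in $p(s_1,\dots,s_n)$, and for each atom $q(t_1,\dots,t_m)$ in $\mathbf B$ and each $j\in[1,m]$, $s_i\in Var(t_j)$ implies $j\in\tau(q)$. $\tau$ is DN for a program if it is DN for each of its clauses. *)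

(* Defs.v *)
From Stdlib Require List.
From mathcomp Require Import all_boot.
From mathcomp Require Import classical_sets cardinality.

Set Implicit Arguments.
Unset Strict Implicit.
Unset Printing Implicit Defensive.

Local Open Scope classical_set_scope.

(* Constant symbols are the function symbols of arity 0. *)
Record language := Language {
  fsym : Type;
  farity : fsym -> nat;
  rsym : Type;
  arity : rsym -> nat;
  infinite_constants : infinite_set [set f : fsym | farity f = 0]
}.

Section Syntax.
Variable L : language.

(* Variables are natural numbers.  The argument positions [1, n] are
   represented by 'I_n, position i being the ordinal i - 1. *)
Inductive term :=
| Var of nat
| App (f : fsym L) of {ffun 'I_(farity f) -> term}.

Inductive atom := Atom (p : rsym L) of {ffun 'I_(arity p) -> term}.

Definition query := seq atom.

Record clause := Clause { chead : atom; cbody : query }.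

Fixpoint term_vars (t : term) : set nat :=
  match t with
  | Var x => [set x]
  | App f a => \bigcup_(i in [set: 'I_(farity f)]) term_vars (a i)
  end.

Definition atom_vars (A : atom) : set nat :=
  let: Atom p s := A in \bigcup_(i in [set: 'I_(arity p)]) term_vars (s i).

Definition query_vars (Q : query) : set nat :=
  [set x | exists2 A, List.In A Q & atom_vars A x].

Definition clause_vars (c : clause) : set nat :=
  atom_vars (chead c) `|` query_vars (cbody c).

(* Number of occurrences of the variable x. *)
Fixpoint term_occ (x : nat) (t : term) : nat :=
  match t with
  | Var y => x == y
  | App f a => \sum_(i < farity f) term_occ x (a i)
  end.

Definition atom_occ (x : nat) (A : atom) : nat :=
  let: Atom p s := A in \sum_(i < arity p) term_occ x (s i).

Record substitution := Substitution {
  subst_fun :> nat -> term;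
  subst_finite : finite_set [set x | subst_fun x <> Var x]
}.

Fixpoint term_subst (theta : substitution) (t : term) : term :=
  match t with
  | Var x => theta x
  | App f a => App [ffun i => term_subst theta (a i)]
  end.

Definition atom_subst (theta : substitution) (A : atom) : atom :=
  let: Atom p s := A in Atom [ffun i => term_subst theta (s i)].

Definition query_subst (theta : substitution) (Q : query) : query :=
  map (atom_subst theta) Q.

Definition clause_subst (theta : substitution) (c : clause) : clause :=
  Clause (atom_subst theta (chead c)) (query_subst theta (cbody c)).

Definition unifier (theta : substitution) (A B : atom) : Prop :=
  atom_subst theta A = atom_subst theta B.

Definition mgu (theta : substitution) (A B : atom) : Prop :=
  unifier theta A B /\
  forall sigma, unifier sigma A B ->
    exists delta, forall x, sigma x = term_subst delta (theta x).

Definition renaming (rho : substitution) : Prop :=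
  exists2 r : nat -> nat, bijective r & forall x, rho x = Var (r x).

Definition variant (c' c : clause) : Prop :=
  exists2 rho, renaming rho & c' = clause_subst rho c.

(* sld_step c theta k Q Q1: Q =>_c^theta Q1, where the selected atom is the
   one at index k (from 0) in Q. *)
Definition sld_step (c : clause) (theta : substitution) (k : nat)
    (Q Q1 : query) : Prop :=
  exists (As : query) (B : atom) (Cs : query) (H : atom) (Bs : query),
    [/\ Q = As ++ B :: Cs /\ size As = k,
        variant (Clause H Bs) c,
        query_vars Q `&` clause_vars (Clause H Bs) = set0,
        mgu theta B H
      & Q1 = query_subst theta (As ++ Bs ++ Cs)].

Definition term_condition := term -> bool.

(* The domain of the partial function Delta p is {i | Delta p i <> None}. *)
Definition delta_filter := forall p : rsym L, 'I_(arity p) -> option term_condition.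

Definition atom_more_general_for (Delta : delta_filter) (eta : substitution)
    (A B : atom) : Prop :=
  exists (p : rsym L) (s t : {ffun 'I_(arity p) -> term}),
    [/\ A = Atom s,
        B = Atom t
      & forall i, match Delta p i with
                  | None => t i = term_subst eta (s i)
                  | Some f => f (s i) = true
                  end].

Definition query_more_general_for (Delta : delta_filter) (eta : substitution)
    (Q Q' : query) : Prop :=
  List.Forall2 (atom_more_general_for Delta eta) Q Q'.

Definition query_more_general (Delta : delta_filter) (Q Q' : query) : Prop :=
  exists eta, query_more_general_for Delta eta Q Q'.

(* The step from Q' to Q1' selecting index k' is a Delta-lift of the step
   from Q to Q1 selecting index k. *)
Definition delta_lift (Delta : delta_filter) (k' : nat) (Q' Q1' : query)
    (k : nat) (Q Q1 : query) : Prop :=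
  [/\ query_more_general Delta Q' Q,
      query_more_general Delta Q1' Q1
    & k' = k].

Definition filter_DN_clause (Delta : delta_filter) (c : clause) : Prop :=
  forall theta k Q Q1, sld_step c theta k Q Q1 ->
  forall Q', query_more_general Delta Q' Q ->
  exists theta' k' Q1',
    sld_step c theta' k' Q' Q1' /\ delta_lift Delta k' Q' Q1' k Q Q1.

Definition filter_DN (Delta : delta_filter) (P : set clause) : Prop :=
  forall c, P c -> filter_DN_clause Delta c.

Definition positions := forall p : rsym L, {set 'I_(arity p)}.

Definition f_true : term_condition := fun=> true.

Definition filter_of (tau : positions) : delta_filter :=
  fun p i => if i \in tau p then Some f_true else None.

Definition positions_DN_clause (tau : positions) (c : clause) : Prop :=
  let: Atom p s := chead c in
  forall i, i \in tau p ->
    exists x, [/\ s i = Var x,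
                  atom_occ x (Atom s) = 1
                & forall (q : rsym L) (t : {ffun 'I_(arity q) -> term}),
                    List.In (Atom t) (cbody c) ->
                    forall j, term_vars (t j) x -> j \in tau q].

Definition positions_DN (tau : positions) (P : set clause) : Prop :=
  forall c, P c -> positions_DN_clause tau c.

End Syntax.

(* Main.v *)
Require Import Defs.
From Stdlib Require Eqdep_dec.
From mathcomp Require Import all_boot.
From mathcomp Require Import boolp classical_sets cardinality.
From mathcomp Require Import zify.

(** Rename the clause apart from [Q'] as well.  Off the positions in [tau] the
  instance by [eta theta] of the selected atom of [Q'] agrees with the instance
  by [theta] of the clause head; at a position of [tau] the head carries a
  variable without other occurrence in the head, which is therefore free to be
  mapped to whatever [Q'] has there.  This yields a unifier of the selected atom
  of [Q'] and the renamed head, hence an mgu through which it factors, and the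
  remaining factor witnesses that the resolvent is more general: the remapped
  variables occur in the body at positions of [tau] only. *)

Set Implicit Arguments.
Unset Strict Implicit.
Unset Printing Implicit Defensive.

Local Open Scope classical_set_scope.

(** * Terms, finiteness of their variables, substitutions and occurrence counts *)

Section Terms.
Variable L : language.
Implicit Types (t u : term L) (A : atom L) (Q : query L) (sigma theta rho : substitution L).

(** Arguments sit inside a finite function, a nested occurrence of [term]. The structural fixpoint
    recurses through [a i], which supplies a hypothesis for each argument. *)
Lemma term_ffun_ind (P : term L -> Prop) :
  (forall x, P (Var L x)) ->
  (forall f (a : {ffun 'I_(farity f) -> term L}), (forall i, P (a i)) -> P (App a)) ->
  forall t, P t.
Proof.
move=> PVar PApp.
exact: (fix F t : P t :=
  match t with
  | Var x => PVar x
  | App f a => PApp f a (fun i => F (a i))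
  end).
Qed.

(** Inversion only gives an equality of dependent pairs over the symbol; it projects because
    equality of symbols is decided classically. *)
Lemma App_inj f (a b : {ffun 'I_(farity f) -> term L}) : App a = App b -> a = b.
Proof.
move=> [e].
exact: (Eqdep_dec.inj_pair2_eq_dec _ (fun x y => pselect (x = y)) _ _ _ _ e).
Qed.

Lemma Atom_inj p (a b : {ffun 'I_(arity p) -> term L}) : Atom a = Atom b -> a = b.
Proof.
move=> [e].
exact: (Eqdep_dec.inj_pair2_eq_dec _ (fun x y => pselect (x = y)) _ _ _ _ e).
Qed.

Lemma term_vars_finite t : finite_set (term_vars t).
Proof.
elim/term_ffun_ind: t => [x|f a IH] /=; first exact: finite_set1.
by apply: bigcup_finite => // i _; exact: IH.
Qed.

Lemma atom_vars_finite A : finite_set (atom_vars A).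
Proof.
by case: A => p s /=; apply: bigcup_finite => // i _; exact: term_vars_finite.
Qed.

Lemma query_vars_finite Q : finite_set (query_vars Q).
Proof.
elim: Q => [|A Q IH].
  by apply: (sub_finite_set _ (finite_set0 nat)) => x [].
apply: (@sub_finite_set _ _ (atom_vars A `|` query_vars Q)).
  by move=> x [B [->|BQ] Bx]; [left|right; exists B].
by rewrite finite_setU; split; [exact: atom_vars_finite|].
Qed.

Lemma finite_nat_bounded (S : set nat) :
  finite_set S -> exists N, forall x, S x -> x < N.
Proof.
case/finite_seqP => s ->; exists (\max_(x <- s) x).+1 => x /= xs.
by rewrite ltnS; exact: leq_bigmax_seq.
Qed.

Lemma bounded_subst_finite N (f : nat -> term L) :
  (forall x, N <= x -> f x = Var L x) -> finite_set [set x | f x <> Var L x].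
Proof.
move=> fN; apply: (sub_finite_set _ (finite_II N)) => x /= fx.
by rewrite ltnNge; apply/negP => /fN.
Qed.

Lemma exists_subst N (f : nat -> term L) :
  (forall x, N <= x -> f x = Var L x) ->
  exists sigma : substitution L, forall x, sigma x = f x.
Proof. by move/bounded_subst_finite=> fin; exists (Substitution fin). Qed.

Lemma exists_id_subst :
  exists sigma : substitution L, forall x, sigma x = Var L x.
Proof. exact: (@exists_subst 0). Qed.

Lemma exists_comp_subst sigma theta :
  exists rho : substitution L, forall x, rho x = term_subst theta (sigma x).
Proof.
have fin : finite_set [set x | term_subst theta (sigma x) <> Var L x].
  apply: (@sub_finite_set _ _ ([set x | sigma x <> Var L x] `|`
                               [set x | theta x <> Var L x])).
    move=> x /= h; have [sx|] := pselect (sigma x = Var L x); last by left.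
    by right => tx; apply: h; rewrite sx.
  by rewrite finite_setU; split; exact: subst_finite.
by exists (Substitution fin).
Qed.

Lemma exists_subst1 x t : exists sigma : substitution L,
  forall y, sigma y = if y == x then t else Var L y.
Proof. by apply: (@exists_subst x.+1) => y; case: eqP => // ->; rewrite ltnn. Qed.

Lemma eq_term_subst sigma theta t :
  (forall x, term_vars t x -> sigma x = theta x) ->
  term_subst sigma t = term_subst theta t.
Proof.
elim/term_ffun_ind: t => [x|f a IH] /= e; first exact: e.
by congr App; apply/ffunP => i; rewrite !ffunE; apply: IH => x ax; apply: e; exists i.
Qed.

Lemma term_subst_comp sigma theta rho t :
  (forall x, term_vars t x -> rho x = term_subst theta (sigma x)) ->
  term_subst theta (term_subst sigma t) = term_subst rho t.
Proof.
elim/term_ffun_ind: t => [x|f a IH] /= e; first by rewrite e.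
by congr App; apply/ffunP => i; rewrite !ffunE; apply: IH => x ax; apply: e; exists i.
Qed.

Lemma term_vars_subst sigma t y : term_vars (term_subst sigma t) y ->
  exists2 x, term_vars t x & term_vars (sigma x) y.
Proof.
elim/term_ffun_ind: t => [x|f a IH] /=; first by exists x.
by case=> i _; rewrite ffunE => /IH[x ax xy]; exists x => //; exists i.
Qed.

Lemma atom_vars_subst sigma A y : atom_vars (atom_subst sigma A) y ->
  exists2 x, atom_vars A x & term_vars (sigma x) y.
Proof.
case: A => p s /= [i _]; rewrite ffunE => /term_vars_subst[x sx xy].
by exists x => //; exists i.
Qed.

Lemma query_vars_subst sigma Q y : query_vars (query_subst sigma Q) y ->
  exists2 x, query_vars Q x & term_vars (sigma x) y.
Proof.
case=> B /List.in_map_iff [A [<- AQ]] /atom_vars_subst[x Ax xy].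
by exists x => //; exists A.
Qed.

Lemma term_vars_occ x t : term_vars t x -> 0 < term_occ x t.
Proof.
elim/term_ffun_ind: t => [y|f a IH] /=; first by move=> ->; rewrite eqxx.
by case=> i _ /IH ai; rewrite (bigD1 i) //= ltn_addr.
Qed.

Lemma term_occ_rename rho (r : nat -> nat) x t :
  injective r -> (forall y, rho y = Var L (r y)) ->
  term_occ (r x) (term_subst rho t) = term_occ x t.
Proof.
move=> rI rhoE; elim/term_ffun_ind: t => [y|f a IH] /=.
  by rewrite rhoE /= (inj_eq rI).
by apply: eq_bigr => i _; rewrite ffunE.
Qed.

(** Position [i] already contributes 1 to the count, so any other position containing [x] would push
    it to at least 2. *)
Lemma atom_occ_once p (s : {ffun 'I_(arity p) -> term L}) i j x :
  s i = Var L x -> atom_occ x (Atom s) = 1 -> term_vars (s j) x -> j = i.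
Proof.
move=> si /= occ1 /term_vars_occ sj; apply/eqP/negPn/negP => ji.
by move: occ1; rewrite (bigD1 i) //= si /= eqxx (bigD1 j) //=; lia.
Qed.

End Terms.

(** * Existence of most general unifiers *)

Section Unification.
Variable L : language.
Implicit Types (t u : term L) (sigma theta rho : substitution L).
Implicit Types E : seq (term L * term L).

Fixpoint term_size t : nat :=
  match t with
  | Var _ => 1
  | App f a => (\sum_(i < farity f) term_size (a i)).+1
  end.

Lemma term_size_gt0 t : 0 < term_size t.
Proof. by case: t. Qed.

Lemma term_size_subst_var sigma t x : term_vars t x ->
  term_size (sigma x) <= term_size (term_subst sigma t).
Proof.
elim/term_ffun_ind: t => [y|f a IH] /=; first by move=> ->.
by case=> i _ /IH h; rewrite (bigD1 i) //= ffunE; lia.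
Qed.

(** If [x] lay strictly inside [t], the instance of [t] would be strictly larger than [sigma x]. *)
Lemma occurs_check sigma t x : term_vars t x ->
  sigma x = term_subst sigma t -> t = Var L x.
Proof.
case: t => [y /= -> //|f a [i _ aix]] /(congr1 term_size) /= e.
have := term_size_subst_var sigma aix.
by rewrite e (bigD1 i) //= ffunE; lia.
Qed.

Definition unifies sigma E : bool :=
  all (fun e => `[< term_subst sigma e.1 = term_subst sigma e.2 >]) E.

(** Left sides suffice: under a unifier both sides of an equation have the same instance. *)
Definition instance_size sigma E : nat :=
  \sum_(e <- E) term_size (term_subst sigma e.1).

(* The factor through which a unifier [sigma] is obtained from [theta] is
  [sigma] itself, as it is for an idempotent mgu. *)
Definition strong_mgu theta E : Prop :=
  unifies theta E /\
  forall sigma, unifies sigma E -> forall x, sigma x = term_subst sigma (theta x).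

Definition args_eqs (f : Defs.fsym L) (a b : {ffun 'I_(farity f) -> term L}) : seq (term L * term L) :=
  [seq (a i, b i) | i <- enum 'I_(farity f)].

Lemma unifies_App sigma (f : Defs.fsym L) (a b : {ffun 'I_(farity f) -> term L}) E :
  unifies sigma ((App a, App b) :: E) = unifies sigma (args_eqs a b ++ E).
Proof.
rewrite /unifies all_cat /= all_map; congr andb.
apply/asboolP/allP => [/App_inj/ffunP ab i _|ab] /=.
  by apply/asboolP; have := ab i; rewrite !ffunE.
congr App; apply/ffunP => i; rewrite !ffunE.
by have /asboolP := ab i (mem_enum _ i).
Qed.

Lemma instance_size_App sigma (f : Defs.fsym L) (a b : {ffun 'I_(farity f) -> term L}) E :
  instance_size sigma ((App a, App b) :: E) =
  (instance_size sigma (args_eqs a b ++ E)).+1.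
Proof.
rewrite /instance_size big_cons big_cat /= big_map big_enum /= addSn.
by congr (_ + _).+1; apply: eq_bigr => i _; rewrite ffunE.
Qed.

Lemma unifies_swap sigma t u E :
  unifies sigma ((t, u) :: E) = unifies sigma ((u, t) :: E).
Proof. by rewrite /unifies /=; congr andb; apply/asbool_equiv_eq; split. Qed.

Lemma unifies_subst sigma theta E :
  (forall x, sigma x = term_subst sigma (theta x)) ->
  unifies sigma [seq (term_subst theta e.1, term_subst theta e.2) | e <- E] =
  unifies sigma E.
Proof.
move=> st; rewrite /unifies all_map; apply: eq_all => e /=.
by rewrite !(@term_subst_comp _ theta sigma sigma).
Qed.

(* The size of the instance of [E] by a unifier decreases at each step of the
  unification algorithm, variable elimination included. *)
Lemma strong_mgu_exists_bounded n E sigma :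
  instance_size sigma E <= n -> unifies sigma E -> exists theta, strong_mgu theta E.
Proof.
elim: n E sigma => [|n IH] E sigma.
  case: E => [_ _|e E]; last first.
    by rewrite /instance_size big_cons; have := term_size_gt0 (term_subst sigma e.1); lia.
  by have [theta thetaE] := exists_id_subst L; exists theta; split=> // rho _ x; rewrite thetaE.
case: E => [_ _|[s t] E].
  by have [theta thetaE] := exists_id_subst L; exists theta; split=> // rho _ x; rewrite thetaE.
(* Variable elimination, isolated because it also serves, after a swap, the equations whose only
   variable side is the right one. *)
have elimvar x u : instance_size sigma ((Var L x, u) :: E) <= n.+1 ->
    unifies sigma ((Var L x, u) :: E) -> exists theta, strong_mgu theta ((Var L x, u) :: E).
  rewrite /instance_size big_cons => /= size_n /andP[/asboolP /= xu uE].
  have size_E : instance_size sigma E <= n.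
    by rewrite /instance_size; have := term_size_gt0 (sigma x); lia.
  have [->|ux] := pselect (u = Var L x).
    have [theta [uth gth]] := IH _ _ size_E uE.
    exists theta; split; first by apply/andP; split=> //; apply/asboolP.
    by move=> rho /andP[_ /gth].
  have [tau tauE] := exists_subst1 x u.
  (* A unifier of [x] and [u] absorbs the elimination [tau]. Hence eliminating [x] from [E] changes
     neither its unifiers of this kind nor the size of its instance by [sigma]. *)
  have factor rho : rho x = term_subst rho u -> forall y, rho y = term_subst rho (tau y).
    by move=> rxu y; rewrite tauE; case: eqP => // ->.
  have size_E' : instance_size sigma
      [seq (term_subst tau e.1, term_subst tau e.2) | e <- E] <= n.
    rewrite /instance_size big_map /=.
    rewrite (eq_bigr (fun e => term_size (term_subst sigma e.1))) => [//|e _].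
    by rewrite (@term_subst_comp _ tau sigma sigma) // => y _; exact: factor.
  have [|theta [uth gth]] := IH _ sigma size_E'.
    by rewrite unifies_subst //; exact: factor.
  have [mu muE] := exists_comp_subst tau theta.
  exists mu; split.
    apply/andP; split.
      apply/asboolP => /=; rewrite muE tauE eqxx.
      apply: eq_term_subst => y uy; rewrite muE tauE.
      (* By the occurs check [x] is not in [u], so [tau] leaves [u] unchanged. *)
      by case: eqP => [yx|//]; case: ux; apply: (@occurs_check sigma) => //; rewrite -yx.
    move: uth; rewrite /unifies all_map; apply: sub_all => e /= /asboolP h.
    by apply/asboolP; rewrite -!(@term_subst_comp _ tau theta mu).
  move=> rho /andP[/asboolP /= /factor rf ruE] y.
  rewrite muE (@term_subst_comp _ theta rho rho) //.
  by move=> z _; apply: gth; rewrite unifies_subst.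
case: s t => [x|f a] [y|g b]; try exact: elimvar.
  move=> size_n; rewrite unifies_swap => un.
  have [|//|theta [uth gth]] := elimvar y (App a).
    move: size_n; rewrite /instance_size !big_cons.
    by move/andP: un => [/asboolP /= -> _].
  by exists theta; split=> [|rho]; rewrite unifies_swap //; exact: gth.
move=> size_n un; have fg : f = g.
  by move/andP: (un) => [/asboolP /= [e _] _].
case: g / fg b size_n un => b size_n un.
have [||theta [uth gth]] := IH (args_eqs a b ++ E) sigma.
- by rewrite instance_size_App in size_n.
- by rewrite -unifies_App.
by exists theta; split=> [|rho]; rewrite unifies_App //; exact: gth.
Qed.

Lemma unifier_mgu sigma (A B : atom L) : unifier sigma A B -> exists theta, mgu theta A B.
Proof.
case: A B => p s [q t] u; have pq : p = q by case: u.
case: q / pq t u => t u.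
pose E := [seq (s i, t i) | i <- enum 'I_(arity p)].
have unifE rho : unifier rho (Atom s) (Atom t) <-> unifies rho E.
  rewrite /unifies all_map; split=> [/Atom_inj/ffunP st|/allP st].
    by apply/allP => i _; apply/asboolP; have := st i; rewrite !ffunE.
  congr Atom; apply/ffunP => i; rewrite !ffunE.
  by have /asboolP := st i (mem_enum _ i).
have [theta [uth gth]] := strong_mgu_exists_bounded (leqnn _) (proj1 (unifE sigma) u).
exists theta; split; first exact/unifE.
by move=> rho /unifE/gth h; exists rho.
Qed.

End Unification.

(** * Renaming apart and lifting of a derivation step *)

Section Lifting.
Variables (L : language) (tau : positions L).
Implicit Types (A B : atom L) (Q : query L) (c : clause L) (eta theta : substitution L).

Lemma more_general_forE eta p (s t : {ffun 'I_(arity p) -> term L}) :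
  atom_more_general_for (filter_of tau) eta (Atom s) (Atom t) <->
  forall i, i \notin tau p -> t i = term_subst eta (s i).
Proof.
split=> [[q [s' [t' [/[dup] es [pq _] et h]]]]|h].
  case: q / pq s' t' es et h => s' t' /Atom_inj <- /Atom_inj <- h i /negPf it.
  by have := h i; rewrite /filter_of it.
exists p, s, t; split=> // i; rewrite /filter_of.
by have [//|/h] := boolP (i \in tau p).
Qed.

(** A renaming is injective: it preserves occurrence counts, and an occurrence of [r x] in the
    renamed body comes from one of [x]. *)
Lemma variant_positions_DN c c' :
  variant c' c -> positions_DN_clause tau c -> positions_DN_clause tau c'.
Proof.
case=> rho [r rbij rhoE] ->; have rI := bij_inj rbij.
case: c => [[p s] Bs]; rewrite /positions_DN_clause /= => DN i /DN[x [six occ1 body]].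
exists (r x); split; first by rewrite ffunE six /= rhoE.
  by rewrite -occ1; apply: eq_bigr => j _; rewrite ffunE (term_occ_rename _ _ rI).
move=> q t /List.in_map_iff [[q' t'] [/[dup] e [qq _] tBs]] j.
case: q / qq t e j => t /Atom_inj <- j.
rewrite ffunE => /term_vars_subst[y ty]; rewrite rhoE => /rI xy.
by apply: (body _ _ tBs); rewrite xy.
Qed.

Lemma variant_trans c1 c2 c3 : variant c1 c2 -> variant c2 c3 -> variant c1 c3.
Proof.
case=> rho [r rbij rhoE] -> [mu [m mbij muE] ->].
have [nu nuE] := exists_comp_subst mu rho.
have compT t : term_subst rho (term_subst mu t) = term_subst nu t.
  by apply: term_subst_comp.
have compA A : atom_subst rho (atom_subst mu A) = atom_subst nu A.
  by case: A => p s /=; congr Atom; apply/ffunP => i; rewrite !ffunE compT.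
exists nu.
  by exists (r \o m); [exact: bij_comp|move=> x; rewrite nuE muE /= rhoE].
rewrite /clause_subst /= compA; congr Clause.
by rewrite /query_subst -map_comp; apply: eq_map => A /=; rewrite compA.
Qed.

(* Exchanges [0, N) and [N, 2N). *)
Definition swap_blocks (N x : nat) : nat :=
  if x < N then x + N else if x < N + N then x - N else x.

Lemma swap_blocksK N : involutive (swap_blocks N).
Proof. by move=> x; rewrite /swap_blocks; do !case: ifP; lia. Qed.

(** A plain shift by [N] is neither surjective nor finitely supported; exchanging two blocks gives a
    bijection with finite support that still moves everything below [N] to [N] or above. *)
Lemma exists_swap_renaming N :
  exists2 rho : substitution L, renaming rho & forall x, rho x = Var L (swap_blocks N x).
Proof.
have [|rho rhoE] := @exists_subst L (N + N) (fun x => Var L (swap_blocks N x)).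
  by move=> x h; congr Var; rewrite /swap_blocks; do !case: ifP; lia.
by exists rho => //; exists (swap_blocks N) => //; exact: inv_bij (swap_blocksK N).
Qed.

Lemma Forall2_map_in (T1 T2 U1 U2 : Type) (R : T1 -> T2 -> Prop)
    (R' : U1 -> U2 -> Prop) (f : T1 -> U1) (g : T2 -> U2) s1 s2 :
  (forall x y, List.In x s1 -> R x y -> R' (f x) (g y)) ->
  List.Forall2 R s1 s2 -> List.Forall2 R' (map f s1) (map g s2).
Proof.
move=> h r; elim: r h => [|x y {}s1 {}s2 Rxy _ IH] h /=; constructor.
  by apply: h => //; left.
by apply: IH => x' y' s1x'; apply: h; right.
Qed.

Lemma positions_DN_filter_DN_clause c :
  positions_DN_clause tau c -> filter_DN_clause (filter_of tau) c.
Proof.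
move=> DNc theta k Q Q1 [As [B [Cs [H [Bs [[-> <-] var _ [uBH _] ->]]]]]] Q' [eta gQ].
have DNv := variant_positions_DN var DNc.
have /List.Forall2_app_inv_r [As' [Cs0 [gAs [gBCs Q'E]]]] := gQ.
inversion gBCs as [|B' ? Cs' ? gB gCs eCs0]; subst.
have [p [u' [u [eB' eB _]]]] := gB.
subst B B'; case: H uBH var DNv => q s uBH; have qp : p = q by case: uBH.
case: q / qp s uBH => s uBH var DNv.
move/more_general_forE: gB => gB.
have [N1 boundQ'] := finite_nat_bounded (query_vars_finite (As' ++ Atom u' :: Cs')).
have [N2 boundH] := finite_nat_bounded (atom_vars_finite (Atom s)).
have [N3 boundBs] := finite_nat_bounded (query_vars_finite Bs).
(* All variables of [Q'] and of the clause variant lie below [N], so the renamed clause uses only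
   [[N, 2N)]. *)
pose N := N1 + N2 + N3.
have Q'N A x : List.In A (As' ++ Atom u' :: Cs') -> atom_vars A x -> x < N.
  move=> AQ' Ax; have : query_vars (As' ++ Atom u' :: Cs') x by exists A.
  by move/boundQ'; rewrite /N; lia.
have u'N i x : term_vars (u' i) x -> x < N.
  by move=> ux; apply: (Q'N (Atom u')); [apply: List.in_elt|exists i].
have sN i x : term_vars (s i) x -> x < N.
  move=> sx; have : atom_vars (Atom s) x by exists i.
  by move/boundH; rewrite /N; lia.
have BsN A x : List.In A Bs -> atom_vars A x -> x < N.
  move=> ABs Ax; have : query_vars Bs x by exists A.
  by move/boundBs; rewrite /N; lia.
have [rho rho_ren rhoE] := exists_swap_renaming N.
have rho_lt x : x < N -> rho x = Var L (x + N).
  by move=> xN; rewrite rhoE /swap_blocks xN.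
(* Detects the variables to be remapped, those forming a head argument at a position of [tau]. *)
pose head_pos x := [pick i : 'I_(arity p) | (i \in tau p) && `[< s i = Var L x >]].
(* The unifier is glued from two blocks: [eta] then [theta] on the variables of [Q'], and on the
   renamed clause variables [theta], except that remapped ones receive the instance of the matching
   argument of [Q']. It is the identity from [2N] on. *)
pose f y := if y < N then term_subst theta (eta y)
  else if y < N + N then
    if head_pos (y - N) is Some i then term_subst theta (term_subst eta (u' i))
    else theta (y - N)
  else Var L y.
have [|sigma sigmaE] := @exists_subst L (N + N) f.
  by move=> y Ny; rewrite /f !ifF //; lia.
have sigma_low t : (forall x, term_vars t x -> x < N) ->
    term_subst sigma t = term_subst theta (term_subst eta t).
  move=> tN; symmetry; apply: term_subst_comp => x /tN xN.
  by rewrite sigmaE /f xN.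
have sigma_high x : x < N -> term_subst sigma (rho x) =
    if head_pos x is Some i then term_subst theta (term_subst eta (u' i)) else theta x.
  move=> xN; rewrite rho_lt //= sigmaE /f addnK.
  by rewrite ltnNge leq_addl ltn_add2r xN.
have sigma_rho t : (forall x, term_vars t x -> x < N) ->
    (forall i, i \in tau p -> forall x, s i = Var L x -> ~ term_vars t x) ->
    term_subst sigma (term_subst rho t) = term_subst theta t.
  move=> tN th; apply: term_subst_comp => x tx.
  rewrite sigma_high; last exact: tN.
  by rewrite /head_pos; case: pickP => // i /andP[it /asboolP six]; case: (th i it x six).
have sigma_tau i : i \in tau p ->
    term_subst sigma (term_subst rho (s i)) = term_subst theta (term_subst eta (u' i)).
  move=> it; have [x [six occ1 _]] := DNv i it.
  have xN : x < N by apply: (sN i); rewrite six.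
  (* The position picked must be [i] itself, as [x] occurs once in the head. *)
  rewrite six /= sigma_high // /head_pos; case: pickP => [j /andP[_ /asboolP sjx]|/(_ i)].
    by rewrite (atom_occ_once (j := j) six occ1) // sjx.
  by rewrite it six asboolT.
have usigma : unifier sigma (Atom u') (atom_subst rho (Atom s)).
  congr Atom; apply/ffunP => i; rewrite !ffunE sigma_low; last exact: u'N.
  have [it|it] := boolP (i \in tau p); first by rewrite sigma_tau.
  rewrite sigma_rho.
  - have /ffunP/(_ i) := Atom_inj uBH; rewrite !ffunE => <-.
    by rewrite gB.
  - exact: sN.
  (* A remapped variable occurring in [s i] would force [i] to be its position in [tau], but [i] is
     outside [tau]. *)
  - move=> j jt x sjx six; have [y [sjy occ1 _]] := DNv j jt.
    move: sjy occ1; rewrite sjx => -[<-] occ1.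
    by move: it; rewrite (atom_occ_once sjx occ1 six) jt.
have [theta' mgu'] := unifier_mgu usigma.
have [delta deltaE] := (proj2 mgu') sigma usigma.
have delta_sigma t : term_subst delta (term_subst theta' t) = term_subst sigma t.
  exact: term_subst_comp.
(* Off [tau], [delta] after [theta'] is [sigma], which acts on [Q'] as [theta] after [eta], and
   [eta] already yields the arguments of [A]. *)
have lift_ctx A A' : List.In A' (As' ++ Atom u' :: Cs') ->
    atom_more_general_for (filter_of tau) eta A' A ->
    atom_more_general_for (filter_of tau) delta (atom_subst theta' A') (atom_subst theta A).
  move=> A'Q' /[dup] -[q [a' [a [A'E -> _]]]]; subst A' => /more_general_forE g.
  apply/more_general_forE => j /g e; rewrite !ffunE delta_sigma e sigma_low //.
  by move=> x ax; apply: (Q'N _ _ A'Q'); exists j.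
(* The body condition enters here: an argument off [tau] contains no remapped variable, so [sigma]
   after [rho] acts on it as [theta]. *)
have lift_body A : List.In A Bs -> atom_more_general_for (filter_of tau) delta
    (atom_subst theta' (atom_subst rho A)) (atom_subst theta A).
  case: A => q a aBs; apply/more_general_forE => j jt.
  rewrite !ffunE delta_sigma sigma_rho // => [x ax|i it x six ax].
    by apply: (BsN _ _ aBs); exists j.
  have [y [siy _ body]] := DNv i it; move: siy body; rewrite six => -[<-] body.
  by move: jt; rewrite (body _ _ aBs _ ax).
exists theta', (size As'), (query_subst theta' (As' ++ query_subst rho Bs ++ Cs')).
split.
  exists As', (Atom u'), Cs', (atom_subst rho (Atom s)), (query_subst rho Bs).
  split=> //.
    by apply: variant_trans var; exists rho.
  apply/seteqP; split=> // y [[A AQ' Ay]] Hy; have yN := Q'N _ _ AQ' Ay.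
  have [x xN xy] : exists2 x, x < N & term_vars (rho x) y.
    case: Hy => /= [[i _]|/query_vars_subst[x [D DBs Dx] xy]].
      by rewrite ffunE => /term_vars_subst[x sx xy]; exists x => //; exact: sN sx.
    by exists x => //; exact: BsN DBs Dx.
  by move: xy; rewrite rho_lt //= => e; move: yN; rewrite e; lia.
split; [by exists eta | | exact: List.Forall2_length gAs].
exists delta; rewrite /query_more_general_for /query_subst !map_cat.
apply: List.Forall2_app; last apply: List.Forall2_app.
- apply: Forall2_map_in gAs => A' A A'As; apply: lift_ctx.
  by apply/List.in_or_app; left.
(* Both resolvents contain instances of the same body [Bs], so its atoms are paired by equality. *)
- rewrite -map_comp; apply: (@Forall2_map_in _ _ _ _ eq) => [A ? ABs <-|].
    exact: lift_body.
  by elim: (Bs) => [|A l IH]; constructor.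
- apply: Forall2_map_in gCs => A' A A'Cs; apply: lift_ctx.
  by apply/List.in_or_app; right; right.
Qed.

End Lifting.

Theorem theorem4 (L : language) (P : set (clause L)) (tau : positions L) :
  finite_set P -> positions_DN tau P -> filter_DN (filter_of tau) P.
Proof. by move=> _ DN c /DN; exact: positions_DN_filter_DN_clause. Qed.
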